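(* In the setting described in the context, with the controllers $u_k=-\Upsilon_k^{-1}M_k\hat x^2_{k|k}$ and $\tilde u_k^1=-\Lambda_k^{-1}L_k(\hat x^1_{k|k}-\hat x^2_{k|k})$, the estimation error covariance $\Sigma^2_{k+1|k}=\mathbb{E}[(x_{k+1}-\hat x^2_{k+1|k})(x_{k+1}-\hat x^2_{k+1|k})']$ can be calculated as $$\begin{aligned}\Sigma^2_{k+1|k}={}&(A-B^1\Gamma_k)\Big\{\big[(I-G^2_{k|k-1}H^2)\Sigma^2_{k|k-1}(I-G^2_{k|k-1}H^2)'+G^2_{k|k-1}Q_{v^2}G^{2'}_{k|k-1}\big]-\Sigma^1_{k|k}\Big\}(A-B^1\Gamma_k)'\\&+A\Sigma^1_{k|k}A'+Q_\omega,\end{aligned}$$ where $\Gamma_k=\Lambda_k^{-1}L_k$ and $\Sigma^1_{k|k}$ is calculated iteratively by $\Sigma^1_{k|k-1}=A\Sigma^1_{k-1|k-1}A'+Q_\omega$, $G_{k|k-1}=\Sigma^1_{k|k-1}H'(H\Sigma^1_{k|k-1}H'+Q_v)^{-1}$, $\Sigma^1_{k|k}=(I-G_{k|k-1}H)\Sigma^1_{k|k-1}(I-G_{k|k-1}H)'+G_{k|k-1}Q_vG_{k|k-1}'$, $\Sigma^1_{0|-1}=\Sigma$.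
   Context: A prime denotes transpose; $\mathbb{E}$ is expectation. System: $x_{k+1}=Ax_k+B^1u_k^1+B^2u_k^2+\omega_k$, $y_k^1=H^1x_k+v_k^1$, $y_k^2=H^2x_k+v_k^2$, with $x_k\in\mathbb{R}^m$, $u_k^1\in\mathbb{R}^l$, $u_k^2\in\mathbb{R}^r$, $y_k^1\in\mathbb{R}^p$, $y_k^2\in\mathbb{R}^q$ and constant matrices of appropriate dimensions. The noises $\omega_k,v_k^1,v_k^2$ have zero mean and covariances $Q_\omega,Q_{v^1},Q_{v^2}$; $x_0$ has mean $\mu$ and covariance $\Sigma$; $x_0$ and all $\omega_k,v_k^1,v_k^2$ are Gaussian and mutually independent. Put $y_k=\begin{bmatrix}y_k^{1'}&y_k^{2'}\end{bmatrix}'=Hx_k+v_k$, $H=\begin{bmatrix}H^{1'}&H^{2'}\end{bmatrix}'$, $v_k=\begin{bmatrix}v_k^{1'}&v_k^{2'}\end{bmatrix}'$, with $Q_v$ the covariance of $v_k$. $\mathcal{F}\{Y_k\}=\sigma\{y_0,\dots,y_k\}$ and $\mathcal{F}\{Y_k^2\}=\sigma\{y_0^2,\dots,y_k^2\}$; $u_k^1$ is $\mathcal{F}\{Y_k\}$-measurable and $u_k^2$ is $\mathcal{F}\{Y_k^2\}$-measurable. Decomposition: $\hat u_k^1=\mathbb{E}[u_k^1\mid\mathcal{F}\{Y_k^2\}]$, $\tilde u_k^1=u_k^1-\hat u_k^1$, $u_k=\begin{bmatrix}\hat u_k^1\\ u_k^2\end{bmatrix}$, $B=\begin{bmatrix}B^1&B^2\end{bmatrix}$,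 $R=\begin{bmatrix}R^1&0\\0&R^2\end{bmatrix}$, so $x_{k+1}=Ax_k+Bu_k+B^1\tilde u_k^1+\omega_k$. $Q,R^1,R^2,\Theta$ are positive semi-definite weighting matrices and $N$ is the horizon; $k=0,\dots,N$. Optimal filter of controller 1 (given $y_0,\dots,y_k$): $\hat x^1_{k|k}=\hat x^1_{k|k-1}+G_{k|k-1}(y_k-H\hat x^1_{k|k-1})$, $\hat x^1_{k|k-1}=A\hat x^1_{k-1|k-1}+Bu_{k-1}+B^1\tilde u^1_{k-1}$, $\hat x^1_{0|-1}=\mu$, with $\Sigma^1_{k|k}=\mathbb{E}[(x_k-\hat x^1_{k|k})(x_k-\hat x^1_{k|k})']$. Optimal filter of controller 2 (given $y_0^2,\dots,y_k^2$): $\hat x^2_{k|k}=\hat x^2_{k|k-1}+G^2_{k|k-1}(y_k^2-H^2\hat x^2_{k|k-1})$, $\hat x^2_{k|k-1}=A\hat x^2_{k-1|k-1}+Bu_{k-1}$, $G^2_{k|k-1}=\Sigma^2_{k|k-1}H^{2'}(H^2\Sigma^2_{k|k-1}H^{2'}+Q_{v^2})^{-1}$, $\hat x^2_{0|-1}=\mu$, $\Sigma^2_{0|-1}=\Sigma$. The error covariance obeys $\Sigma^2_{k+1|k}=A\Sigma^2_{k|k}A'+\mathbb{E}[A(x_k-\hat x^2_{k|k})\tilde u_k^{1'}B^{1'}]+\mathbb{E}[B^1\tilde u_k^1(x_k-\hat x^2_{k|k})'A']+\mathbb{E}[B^1\tilde u_k^1\tilde u_k^{1'}B^{1'}]+Q_\omega$,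 where $\Sigma^2_{k|k}=\mathbb{E}[(x_k-\hat x^2_{k|k})(x_k-\hat x^2_{k|k})']=(I-G^2_{k|k-1}H^2)\Sigma^2_{k|k-1}(I-G^2_{k|k-1}H^2)'+G^2_{k|k-1}Q_{v^2}G^{2'}_{k|k-1}$. Coupled Riccati equations, with $P_{N+1}=S_{N+1}=\Theta$: $P_k=A'P_{k+1}A-M_k'\Upsilon_k^{-1}M_k+Q$, $S_k=A'\Phi_{k+1}A-L_k^{0'}\Lambda_k^{-1}L_k+Q$, where $M_k=B'P_{k+1}A$, $\Upsilon_k=B'P_{k+1}B+R$, $\Phi_k=(P_k-S_k)G^2_{k|k-1}H^2+S_k$, $L_k^0=B^{1'}\Phi_{k+1}'A$, $L_k=B^{1'}\Phi_{k+1}A$, $\Lambda_k=B^{1'}\Phi_{k+1}B^1+R^1$. It is assumed that $\Upsilon_k$ and $\Lambda_k$ are invertible for $k=N,\dots,0$. *)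

(* Defs.v *)
From HB Require Import structures.
From mathcomp Require Import all_boot all_order all_algebra.
From mathcomp Require Import all_classical all_reals all_analysis.

Set Implicit Arguments.
Unset Strict Implicit.
Unset Printing Implicit Defensive.

Import Order.TTheory GRing.Theory Num.Theory.
Import numFieldNormedType.Exports.

Local Open Scope classical_set_scope.
Local Open Scope ring_scope.

Definition psd (R : realType) (n : nat) (M : 'M[R]_n) : Prop :=
  M^T = M /\ forall z : 'cV[R]_n, 0 <= (z^T *m M *m z) 0 0.

Section random_vectors.
Context {R : realType} {d : measure_display} {T : measurableType d}.
Variable P : probability T R.

(* Entrywise; [fine] is harmless as soon as the entries are integrable. *)
Definition mx_expectation (a b : nat) (X : T -> 'M[R]_(a, b)) : 'M[R]_(a, b) :=
  \matrix_(i, j) fine ('E_P[fun t => X t i j]).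

Definition cov_mx (n : nat) (X : T -> 'cV[R]_n) : 'M[R]_n :=
  mx_expectation (fun t =>
    (X t - mx_expectation X) *m (X t - mx_expectation X)^T).

(* E[(X - Y)(X - Y)'] for an estimator Y of X *)
Definition error_cov (n : nat) (X Y : T -> 'cV[R]_n) : 'M[R]_n :=
  mx_expectation (fun t => (X t - Y t) *m (X t - Y t)^T).

(* Membership in [Lfun P 2] includes measurability; it is what gives the mean
   and the covariance a meaning. *)
Definition has_mean_cov (n : nat) (X : T -> 'cV[R]_n)
    (m : 'cV[R]_n) (C : 'M[R]_n) : Prop :=
  [/\ forall i, (fun t => X t i 0) \in Lfun P 2%:E,
      mx_expectation X = m
    & cov_mx X = C].

(* Every linear combination of the entries is normal. The degenerate case is
   separate because [normal_prob m 0] is not the Dirac mass at m. *)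
Definition gaussian (n : nat) (X : T -> 'cV[R]_n) : Prop :=
  forall a : 'cV[R]_n, exists m s : R, forall B : set R, measurable B ->
    P ((fun t => (a^T *m X t) 0 0) @^-1` B) =
    if s == 0 then \d_m B else normal_prob m s B.

Definition sigma_gen (J : Type) (f : J -> T -> R) : set (set T) :=
  <<s \bigcup_j [set f j @^-1` B | B in measurable] >>.

Definition sigma_vec (n : nat) (X : T -> 'cV[R]_n) : set (set T) :=
  sigma_gen (fun i t => X t i 0).

(* sigma(Y 0, ..., Y k) *)
Definition sigma_upto (n : nat) (Y : nat -> T -> 'cV[R]_n) (k : nat) :
    set (set T) :=
  sigma_gen (fun (ji : 'I_k.+1 * 'I_n) t => Y ji.1 t ji.2 0).

(* The family is finite and each F i contains setT, so the product rule over
   the whole index set yields it over every subset. *)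
Definition mutually_independent (I : finType) (F : I -> set (set T)) : Prop :=
  forall E : I -> set T, (forall i, F i (E i)) ->
    P (\bigcap_i E i) = (\prod_i P (E i))%E.

Definition measurable_wrt (G : set (set T)) (n : nat) (X : T -> 'cV[R]_n) :
    Prop :=
  forall i (B : set R), measurable B -> G ((fun t => X t i 0) @^-1` B).

(* Y is a version of E[X | G]. *)
Definition is_cond_exp (G : set (set T)) (n : nat) (X Y : T -> 'cV[R]_n) :
    Prop :=
  measurable_wrt G Y /\
  forall i,
    [/\ P.-integrable setT (fun t => (X t i 0)%:E),
        P.-integrable setT (fun t => (Y t i 0)%:E)
      & forall A, G A ->
          (\int[P]_(t in A) (Y t i 0)%:E = \int[P]_(t in A) (X t i 0)%:E)%E].

(* sigma-algebras of x0 and of the noises at times 0, ..., N *)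
Definition primitive_sigma (m p q N : nat) (x0 : T -> 'cV[R]_m)
    (w : nat -> T -> 'cV[R]_m) (v1 : nat -> T -> 'cV[R]_p)
    (v2 : nat -> T -> 'cV[R]_q)
    (i : unit + ('I_N.+1 + ('I_N.+1 + 'I_N.+1))) : set (set T) :=
  match i with
  | inl _ => sigma_vec x0
  | inr (inl k) => sigma_vec (w k)
  | inr (inr (inl k)) => sigma_vec (v1 k)
  | inr (inr (inr k)) => sigma_vec (v2 k)
  end.

End random_vectors.

(* Main.v *)
Require Import Defs.
From HB Require Import structures.
From mathcomp Require Import all_boot all_order all_algebra.
From mathcomp Require Import all_classical all_reals all_analysis.
From mathcomp Require Import measurable_realfun.

Set Implicit Arguments.
Unset Strict Implicit.
Unset Printing Implicit Defensive.

Import Order.TTheory GRing.Theory Num.Theory.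
Import numFieldNormedType.Exports.

Local Open Scope classical_set_scope.
Local Open Scope ring_scope.

(** Under the given controllers every signal is, pointwise, an affine function
    of the initial state and of the noises up to the current time, with
    deterministic coefficients. Two kinds of orthogonality in L2 then give all
    the formulas by bilinearity of (X, Y) |-> E[X Y'] ([cross_moment]).

    The first kind is between the past and a fresh noise W. Independence gives
    E[Z W'] = 0 when Z is the initial state or a noise that enters before W
    ([independent_cross_moment]), and the set of Z with E[Z W'] = 0 is closed
    under affine maps because W is centered; so W is orthogonal to all signals
    built before it enters the system. This yields the recursions
    Sigma1(k+1|k) = A Sigma1(k|k) A' + Qw and the Joseph form of both filtering
    covariances ([error_cov_update]).

    The second kind is between a filtering error and the information behind it:
    the error x - E[x | F] is orthogonal to every square-integrable F-measurable
    vector ([cond_exp_orthogonal]). Applied to the innovation of controller 1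
    it is the normal equation Sigma1 H' = G (H Sigma1 H' + Qv), which determines
    the gain ([optimal_gain]). Applied to delta = xf1 - xf2, which is measurable
    for the larger sigma-algebra of controller 1, it shows that the two terms of
    x - xf2 = (x - xf1) + delta are orthogonal, so that
    E[delta delta'] = Sigma2(k|k) - Sigma1(k|k). The prediction error of
    controller 2 is
      A (x - xf1) + (A - B1 Gamma) delta + w,
    a sum of three mutually orthogonal terms, and the stated formula is the sum
    of their covariances.

    Both kinds of orthogonality rest on a single measure-theoretic fact,
    [integral_mul_null]: if D integrates to zero over every set of a
    sigma-algebra, then E[D Z] = 0 for Z measurable with respect to it. For
    conditional expectations D is the error; for independence the fact is
    used twice, on sigma(W) with D = 1_A - P(A) and then on sigma(X) with
    D = W. *)

(** * Functions with zero integral over a sigma-algebra *)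

Section null_integrals.
Context {R : realType} {d : measure_display} {T : measurableType d}.
Variable P : probability T R.
Import HBSimple HBNNSimple.
Local Open Scope ereal_scope.

(** A simple function measurable for the small sigma-algebra is a finite
    combination of indicators of its level sets, which lie in that
    sigma-algebra. *)
Lemma integral_mul_sfun_null (C : set (set T)) (D : T -> R)
    (h : {sfun (g_sigma_algebraType C) >-> R}) :
  <<s C >> `<=` measurable ->
  P.-integrable setT (EFin \o D) ->
  (forall A, <<s C >> A -> \int[P]_(t in A) (D t)%:E = 0) ->
  \int[P]_t (D t * h t)%:E = 0.
Proof.
move=> Cm iD D0.
have hA y : <<s C >> (h @^-1` [set y]) by exact: (measurable_sfunP h).
under eq_integral => t _.
  rewrite (fimfunEord h) mulr_sumr -sumEFin.
  under eq_bigr => i _ do rewrite mulrCA EFinM.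
  over.
have iDA (A : set T) : <<s C >> A ->
    P.-integrable setT (fun t => (D t * \1_A t)%:E).
  move=> /Cm mA; apply: (le_integrable _ _ _ iD) => //.
    apply/measurable_EFinP/measurable_funM => //.
    by apply/measurable_EFinP; exact: measurable_int iD.
  move=> t _ /=; rewrite lee_fin normrM indicE.
  by case: (_ \in _); rewrite ?normr1 ?mulr1// normr0 mulr0.
rewrite integral_sum//; last first.
  by move=> i; apply: integrableZl => //; exact: iDA.
rewrite big1// => i _; rewrite integralZl//; last exact: iDA.
set A := h @^-1` _.
have -> : (fun t => (D t * \1_A t)%:E) = (EFin \o D) \_ A.
  by rewrite epatch_indic; apply/funext => t; rewrite /= EFinM.
by rewrite -integral_mkcond D0 ?mule0//; exact: hA.
Qed.

(** The dyadic approximations of Z from below are simple for the small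
    sigma-algebra, and |D Z| dominates their products with D. *)
Lemma integral_mul_ge0_null (C : set (set T)) (D Z : T -> R) :
  <<s C >> `<=` measurable ->
  P.-integrable setT (EFin \o D) ->
  (forall A, <<s C >> A -> \int[P]_(t in A) (D t)%:E = 0) ->
  (forall t, (0 <= Z t)%R) ->
  measurable_fun setT (Z : g_sigma_algebraType C -> R) ->
  P.-integrable setT (fun t => (D t * Z t)%:E) ->
  \int[P]_t (D t * Z t)%:E = 0.
Proof.
move=> Cm iD D0 Z0 mZ iDZ.
have mD : measurable_fun setT D.
  by apply/measurable_EFinP; exact: measurable_int iD.
have mEZ : measurable_fun setT (EFin \o Z : g_sigma_algebraType C -> \bar R).
  exact/measurable_EFinP.
pose h := nnsfun_approx (@measurableT _ (g_sigma_algebraType C)) mEZ.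
have mh n : measurable_fun setT (h n : T -> R).
  move=> _ B mB; rewrite setTI; apply: Cm.
  exact: (measurable_sfunP (h n)).
have hZ n t : (h n t <= Z t)%R.
  rewrite /h nnsfun_approxE -lee_fin; apply: le_approx => // x _.
  by rewrite lee_fin.
have [] := @dominated_convergence _ _ _ P setT measurableT
    (fun n t => (D t * h n t)%:E) (fun t => (D t * Z t)%:E)
    (fun t => `|(D t * Z t)%:E|).
- by move=> n; apply/measurable_EFinP/measurable_funM => //; exact: mh.
- exact: measurable_int iDZ.
- apply: aeW => t _; under eq_fun do rewrite EFinM.
  rewrite EFinM; apply: cvgeZl => //.
  by apply: cvg_nnsfun_approx => // x _; rewrite lee_fin.
- exact: integrable_abse.
- apply: aeW => t n _; rewrite lee_fin !normrM ler_wpM2l//.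
  by rewrite !ger0_norm//; exact: hZ.
move=> _ _ /(cvg_lim (@ereal_hausdorff _)) <-.
apply/cvg_lim => //; apply: cvg_near_cst; apply: nearW => n.
exact: (@integral_mul_sfun_null C D (h n) Cm iD D0).
Qed.

(** The positive and negative parts of Z are measurable for the same
    sigma-algebra, and |D Z| dominates their products with D. *)
Lemma integral_mul_null (C : set (set T)) (D Z : T -> R) :
  <<s C >> `<=` measurable ->
  P.-integrable setT (EFin \o D) ->
  (forall A, <<s C >> A -> \int[P]_(t in A) (D t)%:E = 0) ->
  (forall B, measurable B -> <<s C >> (Z @^-1` B)) ->
  P.-integrable setT (fun t => (D t * Z t)%:E) ->
  \int[P]_t (D t * Z t)%:E = 0.
Proof.
move=> Cm iD D0 CZ iDZ.
have mZ : measurable_fun setT (Z : g_sigma_algebraType C -> R).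
  by move=> _ B mB; rewrite setTI; exact: CZ.
have mDf (W : T -> R) : measurable_fun setT (W : g_sigma_algebraType C -> R) ->
    measurable_fun setT (fun t => (D t * W t)%:E).
  move=> mW; apply/measurable_EFinP/measurable_funM.
    by apply/measurable_EFinP; exact: measurable_int iD.
  by move=> _ B mB; apply: Cm; exact: mW.
have mp := measurable_funrpos mZ; have mn := measurable_funrneg mZ.
have ip : P.-integrable setT (fun t => (D t * (Z^\+)%R t)%:E).
  apply: (le_integrable _ (mDf _ mp) _ iDZ) => // t _.
  rewrite lee_fin !normrM ler_wpM2l// ger0_norm ?funrpos_ge0//.
  by rewrite /funrpos ge_max ler_norm normr_ge0.
have ineg : P.-integrable setT (fun t => (D t * (Z^\-)%R t)%:E).
  apply: (le_integrable _ (mDf _ mn) _ iDZ) => // t _.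
  rewrite lee_fin !normrM ler_wpM2l// ger0_norm ?funrneg_ge0//.
  by rewrite /funrneg ge_max -normrN ler_norm normr_ge0.
under eq_integral => t _.
  rewrite (_ : Z t = (Z^\+)%R t - (Z^\-)%R t)%R ?mulrBr ?EFinB; last first.
    by rewrite -{1}(funrposBneg Z).
  over.
rewrite integralB_EFin//.
by rewrite !(integral_mul_ge0_null Cm iD D0)// subee.
Qed.

End null_integrals.

(** * Generated sigma-algebras *)

Section generated_sigma_algebras.
Context {R : realType} {d : measure_display} {T : measurableType d}.

Lemma sigma_gen_preimage (J : Type) (f : J -> T -> R) j (B : set R) :
  measurable B -> sigma_gen f (f j @^-1` B).
Proof. by move=> mB; apply: sub_sigma_algebra; exists j => //; exists B. Qed.

Lemma sigma_gen_sub (J : Type) (f : J -> T -> R) (S : set (set T)) :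
  sigma_algebra setT S ->
  (forall j (B : set R), measurable B -> S (f j @^-1` B)) ->
  sigma_gen f `<=` S.
Proof.
by move=> sS fS; apply: smallest_sub => // _ [j _ [B mB <-]]; exact: fS.
Qed.

Lemma sigma_algebra_sigma_gen (J : Type) (f : J -> T -> R) :
  sigma_algebra setT (sigma_gen f).
Proof. exact: smallest_sigma_algebra. Qed.

Lemma sigma_gen_setT (J : Type) (f : J -> T -> R) : sigma_gen f setT.
Proof.
rewrite -(setD0 setT).
by case: (sigma_algebra_sigma_gen f) => s0 sC _; exact: sC.
Qed.

Lemma sigma_upto_obs (n : nat) (Y : nat -> T -> 'cV[R]_n) (j k : nat) :
  (j <= k)%N -> measurable_wrt (sigma_upto Y k) (Y j).
Proof.
rewrite -ltnS => jk i B mB.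
exact: (@sigma_gen_preimage _
  (fun (ji : 'I_k.+1 * 'I_n) t => Y ji.1 t ji.2 0) (Ordinal jk, i) _ mB).
Qed.

Lemma sigma_upto_sub (n : nat) (Y : nat -> T -> 'cV[R]_n) k (S : set (set T)) :
  sigma_algebra setT S ->
  (forall j, (j <= k)%N -> measurable_wrt S (Y j)) -> sigma_upto Y k `<=` S.
Proof.
move=> sS YS; apply: sigma_gen_sub => // -[j i] B mB /=.
by apply: YS => //; exact: (ltn_ord j).
Qed.

Lemma measurable_wrt_sub (G G' : set (set T)) n (X : T -> 'cV[R]_n) :
  G `<=` G' -> measurable_wrt G X -> measurable_wrt G' X.
Proof. by move=> sG mX i B mB; apply: sG; exact: mX. Qed.

End generated_sigma_algebras.

(** * Second moments of random vectors *)

Section second_order.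
Context {R : realType} {d : measure_display} {T : measurableType d}.
Variable P : probability T R.

Let mean (f : T -> R) : R := fine 'E_P[f].

Let meanD f g : f \in Lfun P 1 -> g \in Lfun P 1 ->
  mean (f \+ g) = mean f + mean g.
Proof.
by move=> lf lg; rewrite /mean expectationD// fineD// expectation_fin_num.
Qed.

Let meanZ a f : f \in Lfun P 1 -> mean (fun t => a * f t) = a * mean f.
Proof.
move=> lf; rewrite /mean -[in RHS](@fineK _ 'E_P[f]) ?expectation_fin_num//=.
rewrite -[RHS]/(fine (a * fine ('E_P[f]))%:E).
rewrite EFinM fineK ?expectation_fin_num// -expectationZl//.
by congr (fine 'E_P[_]); apply/funext => t /=; rewrite mulrC.
Qed.

Let mean_sum (I : finType) (f : I -> T -> R) : (forall i, f i \in Lfun P 1) ->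
  mean (fun t => \sum_i f i t) = \sum_i mean (f i).
Proof.
move=> lf.
suff [] : \sum_i f i \in Lfun P 1 /\ mean (\sum_i f i) = \sum_i mean (f i).
  move=> _ <-; congr mean; apply/funext => t.
  by rewrite fct_sumE.
elim/big_ind2 : _ => [|f1 m1 f2 m2 [l1 <-] [l2 <-]|i _]; last by [].
  split; first exact: rpred0.
  by rewrite /mean (expectation_cst P 0).
by split; [exact: rpredD|rewrite -meanD].
Qed.

Definition square_integrable n (X : T -> 'cV[R]_n) : Prop :=
  forall i, (fun t => X t i 0) \in Lfun P 2%:E.

Definition cross_moment a b (X : T -> 'cV[R]_a) (Y : T -> 'cV[R]_b) :
  'M[R]_(a, b) := mx_expectation P (fun t => X t *m (Y t)^T).

Lemma cross_momentE a b (X : T -> 'cV[R]_a) (Y : T -> 'cV[R]_b) i j :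
  cross_moment X Y i j = fine 'E_P[fun t => X t i 0 * Y t j 0].
Proof.
rewrite mxE; congr (fine 'E_P[_]); apply/funext => t.
by rewrite mxE big_ord1 mxE.
Qed.

Let Lfun2_submod : submod_closed (Lfun P 2%:E).
Proof. by apply: Lfun_submod_closed; rewrite lee_fin ler1n. Qed.

Lemma square_integrableM a b (A : 'M[R]_(a, b)) (X : T -> 'cV[R]_b) :
  square_integrable X -> square_integrable (fun t => A *m X t).
Proof.
have [L0 LZD] := Lfun2_submod.
move=> lX i.
have -> : (fun t => (A *m X t) i 0) = \sum_k A i k *: (fun t => X t k 0).
  by apply/funext => t; rewrite mxE fct_sumE.
rewrite -big_enum; elim: (enum _) => [|k s IHs]; first by rewrite big_nil.
by rewrite big_cons; exact: LZD.
Qed.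

Lemma square_integrableD n (X Y : T -> 'cV[R]_n) : square_integrable X ->
  square_integrable Y -> square_integrable (fun t => X t + Y t).
Proof.
have [_ LZD] := Lfun2_submod.
move=> lX lY i.
have -> : (fun t => (X t + Y t) i 0) =
    1 *: (fun t => X t i 0) + (fun t => Y t i 0).
  by rewrite scale1r; apply/funext => t; rewrite mxE.
exact: LZD.
Qed.

Lemma square_integrableB n (X Y : T -> 'cV[R]_n) : square_integrable X ->
  square_integrable Y -> square_integrable (fun t => X t - Y t).
Proof.
move=> lX lY.
have -> : (fun t => X t - Y t) = (fun t => X t + (- 1%:M) *m Y t).
  by apply/funext => t; rewrite mulNmx mul1mx.
by apply: square_integrableD => //; exact: square_integrableM.
Qed.

Lemma square_integrable_cst n (c : 'cV[R]_n) : square_integrable (fun=> c).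
Proof. by move=> i; exact: Lfun_cst. Qed.

Lemma square_integrable_col_mx a b (X : T -> 'cV[R]_a) (Y : T -> 'cV[R]_b) :
  square_integrable X -> square_integrable Y ->
  square_integrable (fun t => col_mx (X t) (Y t)).
Proof.
move=> lX lY i; have [k ->|k ->] := split_ordP i.
  by under eq_fun do rewrite col_mxEu; exact: lX.
by under eq_fun do rewrite col_mxEd; exact: lY.
Qed.

Let cross_Lfun1 a b (X : T -> 'cV[R]_a) (Y : T -> 'cV[R]_b) i j :
  square_integrable X -> square_integrable Y ->
  (fun t => X t i 0 * Y t j 0) \in Lfun P 1.
Proof. by move=> lX lY; exact: (Lfun2_mul_Lfun1 (lX i) (lY j)). Qed.

Lemma cross_moment_tr a b (X : T -> 'cV[R]_a) (Y : T -> 'cV[R]_b) :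
  (cross_moment X Y)^T = cross_moment Y X.
Proof.
apply/matrixP => i j; rewrite mxE !cross_momentE; congr (fine 'E_P[_]).
by apply/funext => t; rewrite mulrC.
Qed.

Lemma cross_momentDl a b (X Y : T -> 'cV[R]_a) (Z : T -> 'cV[R]_b) :
  square_integrable X -> square_integrable Y -> square_integrable Z ->
  cross_moment (fun t => X t + Y t) Z = cross_moment X Z + cross_moment Y Z.
Proof.
move=> lX lY lZ; apply/matrixP => i j; rewrite [RHS]mxE !cross_momentE.
rewrite -[RHS]meanD ?cross_Lfun1//; congr mean.
by apply/funext => t; rewrite mxE mulrDl.
Qed.

Lemma cross_momentMl a b c (A : 'M[R]_(a, b)) (X : T -> 'cV[R]_b)
    (Z : T -> 'cV[R]_c) : square_integrable X -> square_integrable Z ->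
  cross_moment (fun t => A *m X t) Z = A *m cross_moment X Z.
Proof.
move=> lX lZ; apply/matrixP => i j; rewrite cross_momentE [RHS]mxE.
under [RHS]eq_bigr do
  rewrite cross_momentE -[fine _]/(mean _) -meanZ ?cross_Lfun1//.
rewrite -mean_sum; last first.
  by move=> k; rewrite rpredZ// cross_Lfun1.
congr mean; apply/funext => t.
rewrite mxE mulr_suml.
by apply: eq_bigr => k _; rewrite mulrA.
Qed.

Lemma cross_momentBl a b (X Y : T -> 'cV[R]_a) (Z : T -> 'cV[R]_b) :
  square_integrable X -> square_integrable Y -> square_integrable Z ->
  cross_moment (fun t => X t - Y t) Z = cross_moment X Z - cross_moment Y Z.
Proof.
move=> lX lY lZ.
have -> : (fun t => X t - Y t) = (fun t => X t + (- 1%:M) *m Y t).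
  by apply/funext => t; rewrite mulNmx mul1mx.
rewrite cross_momentDl//; last exact: square_integrableM.
by rewrite cross_momentMl// mulNmx mul1mx.
Qed.

Lemma cross_momentDr a b (X : T -> 'cV[R]_a) (Y Z : T -> 'cV[R]_b) :
  square_integrable X -> square_integrable Y -> square_integrable Z ->
  cross_moment X (fun t => Y t + Z t) = cross_moment X Y + cross_moment X Z.
Proof.
move=> lX lY lZ; rewrite -cross_moment_tr cross_momentDl// raddfD/=.
by rewrite !cross_moment_tr.
Qed.

Lemma cross_momentBr a b (X : T -> 'cV[R]_a) (Y Z : T -> 'cV[R]_b) :
  square_integrable X -> square_integrable Y -> square_integrable Z ->
  cross_moment X (fun t => Y t - Z t) = cross_moment X Y - cross_moment X Z.
Proof.
move=> lX lY lZ; rewrite -cross_moment_tr cross_momentBl// raddfB/=.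
by rewrite !cross_moment_tr.
Qed.

Lemma cross_momentMr a b c (A : 'M[R]_(a, b)) (X : T -> 'cV[R]_c)
    (Y : T -> 'cV[R]_b) : square_integrable X -> square_integrable Y ->
  cross_moment X (fun t => A *m Y t) = cross_moment X Y *m A^T.
Proof.
move=> lX lY; rewrite -cross_moment_tr cross_momentMl// trmx_mul.
by rewrite !cross_moment_tr.
Qed.

Lemma cross_moment_col_mxl a b c (X : T -> 'cV[R]_a) (Y : T -> 'cV[R]_b)
    (Z : T -> 'cV[R]_c) :
  cross_moment (fun t => col_mx (X t) (Y t)) Z =
  col_mx (cross_moment X Z) (cross_moment Y Z).
Proof.
apply/matrixP => i j; rewrite !mxE.
case: split_ordP => k ->; rewrite !mxE; congr (fine 'E_P[_]);
  by apply/funext => t; rewrite !mxE; apply: eq_bigr => o _;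
    rewrite ?col_mxEu ?col_mxEd.
Qed.

Lemma square_integrable_measurable n (X : T -> 'cV[R]_n) :
  square_integrable X -> measurable_wrt measurable X.
Proof.
move=> lX i B mB; rewrite -[_ @^-1` _]setTI.
by move: (lX i); rewrite inE => /andP[/[!inE] mX _]; exact: mX.
Qed.

Let square_integrable_integrable n (X : T -> 'cV[R]_n) i :
  square_integrable X -> P.-integrable setT (fun t => (X t i 0)%:E).
Proof.
move=> lX; apply/Lfun1_integrable; apply: Lfun_subset12 (lX i).
exact: fin_num_measure.
Qed.

Let cross_integrable a b (X : T -> 'cV[R]_a) (Y : T -> 'cV[R]_b) i j :
  square_integrable X -> square_integrable Y ->
  P.-integrable setT (fun t => (X t i 0 * Y t j 0)%:E).
Proof. by move=> lX lY; apply/Lfun1_integrable; exact: cross_Lfun1. Qed.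

(** The defining property of the conditional expectation says that X - Y
    integrates to zero over the sets of the conditioning sigma-algebra. *)
Lemma cond_exp_orthogonal (J : Type) (f : J -> T -> R) a b
    (X Y : T -> 'cV[R]_a) (Z : T -> 'cV[R]_b) :
  sigma_gen f `<=` measurable ->
  square_integrable X -> square_integrable Y -> square_integrable Z ->
  is_cond_exp P (sigma_gen f) X Y -> measurable_wrt (sigma_gen f) Z ->
  cross_moment (fun t => X t - Y t) Z = 0.
Proof.
move=> Fm lX lY lZ [_ XY] mZ; apply/matrixP => i j.
rewrite cross_momentE unlock [in RHS]mxE.
have lXY := square_integrableB lX lY.
rewrite (integral_mul_null (Fm : <<s _ >> `<=` _)
  (square_integrable_integrable i lXY) _ (mZ j)
  (cross_integrable _ _ lXY lZ))//.
move=> A FA; have mA := Fm _ FA; have [iX iY e] := XY i.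
under eq_integral => t _ do rewrite !mxE EFinB.
rewrite integralB_EFin//; [|exact: integrableS iX|exact: integrableS iY].
by rewrite e// subee// integrable_fin_num//; exact: integrableS iX.
Qed.

(** It suffices that W integrates to zero over every A in sigma(X). For this,
    1_A - P(A) integrates to zero over every B in sigma(W), by the product rule
    for A and B, so it is orthogonal to W; and W has mean zero. *)
Lemma independent_cross_moment a b (X : T -> 'cV[R]_a) (W : T -> 'cV[R]_b) :
  square_integrable X -> square_integrable W -> mx_expectation P W = 0 ->
  (forall A B, sigma_vec X A -> sigma_vec W B -> P (A `&` B) = P A * P B)%E ->
  cross_moment X W = 0.
Proof.
move=> lX lW W0 XW.
have mXs : sigma_vec X `<=` measurable.
  apply: sigma_gen_sub => [|i B mB]; first exact: sigma_algebra_measurable.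
  exact: square_integrable_measurable.
have mWs : sigma_vec W `<=` measurable.
  apply: sigma_gen_sub => [|i B mB]; first exact: sigma_algebra_measurable.
  exact: square_integrable_measurable.
have fP A : measurable A -> P A \is a fin_num by exact: fin_num_measure.
rewrite -cross_moment_tr; apply/matrixP => i j; rewrite mxE [in RHS]mxE.
have iW := square_integrable_integrable j lW.
rewrite cross_momentE unlock.
rewrite (integral_mul_null (mXs : <<s _ >> `<=` _)
  (square_integrable_integrable j lW) _ _ (cross_integrable _ _ lW lX))//;
  last exact: (@sigma_gen_preimage _ _ _ _ (fun i t => X t i 0) i).
move=> A XA; have mA := mXs _ XA.
pose D t : R := \1_A t - fine (P A).
have iA : P.-integrable setT (EFin \o (\1_A : T -> R)).
  exact: integrable_indic.
have ic : P.-integrable setT (EFin \o (cst (fine (P A)) : T -> R)).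
  exact: finite_measure_integrable_cst.
have iD : P.-integrable setT (EFin \o D).
  have := integrableB measurableT iA ic.
  by apply: eq_integrable => // t _ /=; rewrite EFinB.
have D0 B : sigma_vec W B -> (\int[P]_(t in B) (D t)%:E = 0)%E.
  move=> WB; have mB := mWs _ WB.
  rewrite /D; under eq_integral => t _ do rewrite EFinB.
  rewrite integralB_EFin//; [|exact: integrableS iA|exact: integrableS ic].
  rewrite integral_indic// integral_cst// fineK ?fP//.
  by rewrite [X in (X - _)%E](XW _ _ XA WB) subee// fin_numM ?fP.
have iAW : P.-integrable setT (fun t => (\1_A t * W t j 0)%:E).
  apply: (le_integrable _ _ _ iW) => //.
    apply/measurable_EFinP/measurable_funM => //.
    by apply/measurable_EFinP; exact: measurable_int iW.
  move=> t _ /=; rewrite lee_fin normrM indicE.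
  by case: (_ \in _); rewrite ?normr1 ?mul1r// normr0 mul0r.
have icW : P.-integrable setT (fun t => (fine (P A) * W t j 0)%:E).
  by under eq_fun do rewrite EFinM; exact: integrableZl.
have iDW : P.-integrable setT (fun t => (D t * W t j 0)%:E).
  under eq_fun do rewrite mulrBl EFinB.
  exact: integrableB.
have := integral_mul_null (mWs : <<s _ >> `<=` _) iD D0
  (@sigma_gen_preimage _ _ _ _ (fun i t => W t i 0) j) iDW.
under eq_integral => t _ do rewrite mulrBl EFinB.
rewrite integralB_EFin//.
under [X in (_ - X)%E]eq_integral => t _ do rewrite EFinM.
rewrite integralZl//.
have -> : (\int[P]_t (W t j 0)%:E = 0)%E.
  move/matrixP/(_ j 0) : W0; rewrite !mxE unlock => W0.
  by rewrite -[LHS]fineK ?W0// integrable_fin_num.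
rewrite mule0 sube0 => <-.
rewrite [LHS]integral_mkcond epatch_indic; apply: eq_integral => t _ /=.
by rewrite -EFinM mulrC.
Qed.

(** Taking the whole space at all the other indices reduces the product rule
    to two factors. *)
Lemma mutually_independent_pair (I : finType) (F : I -> set (set T)) i j A B :
  (forall k, F k setT) -> mutually_independent P F -> i != j ->
  F i A -> F j B -> (P (A `&` B) = P A * P B)%E.
Proof.
move=> FT Fi ij FA FB.
pose E k := if k == i then A else if k == j then B else setT.
have Ei : E i = A by rewrite /E eqxx.
have Ej : E j = B by rewrite /E eq_sym (negbTE ij) eqxx.
have FE k : F k (E k).
  rewrite /E; case: eqP => [->//|_]; case: eqP => [->//|_]; exact: FT.
have := Fi E FE.
rewrite (bigD1 i)//= (bigD1 j) 1?eq_sym//= big1 ?mule1 ?Ei ?Ej =>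
  [<-|k /andP[ki kj]].
  congr (P _); apply/seteqP; split => [t [At Bt] k _|t Et].
    by rewrite /E; case: eqP => // _; case: eqP.
  by split; [have := Et i Logic.I; rewrite Ei|have := Et j Logic.I; rewrite Ej].
by rewrite /E (negbTE ki) (negbTE kj) probability_setT.
Qed.

Lemma cross_moment_cstl a b (c : 'cV[R]_a) (W : T -> 'cV[R]_b) :
  square_integrable W ->
  cross_moment (fun=> c) W = c *m (mx_expectation P W)^T.
Proof.
move=> lW; apply/matrixP => i j; rewrite cross_momentE mxE big_ord1 !mxE.
rewrite -[RHS]meanZ//; apply: Lfun_subset12 (lW j).
exact: fin_num_measure.
Qed.

Lemma cov_mx_centered n (W : T -> 'cV[R]_n) :
  mx_expectation P W = 0 -> cov_mx P W = cross_moment W W.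
Proof.
move=> W0; rewrite /cov_mx W0; congr mx_expectation.
by apply/funext => t; rewrite subr0.
Qed.

Lemma mx_expectation_col_mx0 a b (X : T -> 'cV[R]_a) (Y : T -> 'cV[R]_b) :
  mx_expectation P X = 0 -> mx_expectation P Y = 0 ->
  mx_expectation P (fun t => col_mx (X t) (Y t)) = 0.
Proof.
move=> X0 Y0; apply/matrixP => i j; rewrite ord1 !mxE.
have [k ->|k ->] := split_ordP i.
  under eq_fun do rewrite col_mxEu.
  by move/matrixP/(_ k 0) : X0; rewrite !mxE.
under eq_fun do rewrite col_mxEd.
by move/matrixP/(_ k 0) : Y0; rewrite !mxE.
Qed.

(** Square integrability is part of the predicate so that its closure
    properties propagate both facts along the recursions at once. *)
Definition orthogonal_to b (W : T -> 'cV[R]_b) a (X : T -> 'cV[R]_a) : Prop :=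
  square_integrable X /\ cross_moment X W = 0.

Section orthogonal_to_closed.
Variables (b : nat) (W : T -> 'cV[R]_b).
Hypothesis lW : square_integrable W.

Lemma orthogonal_toD a (X Y : T -> 'cV[R]_a) : orthogonal_to W X ->
  orthogonal_to W Y -> orthogonal_to W (fun t => X t + Y t).
Proof.
move=> [lX X0] [lY Y0]; split; first exact: square_integrableD.
by rewrite cross_momentDl// X0 Y0 addr0.
Qed.

Lemma orthogonal_toB a (X Y : T -> 'cV[R]_a) : orthogonal_to W X ->
  orthogonal_to W Y -> orthogonal_to W (fun t => X t - Y t).
Proof.
move=> [lX X0] [lY Y0]; split; first exact: square_integrableB.
by rewrite cross_momentBl// X0 Y0 subr0.
Qed.

Lemma orthogonal_toM a c (A : 'M[R]_(a, c)) (X : T -> 'cV[R]_c) :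
  orthogonal_to W X -> orthogonal_to W (fun t => A *m X t).
Proof.
move=> [lX X0]; split; first exact: square_integrableM.
by rewrite cross_momentMl// X0 mulmx0.
Qed.

Lemma orthogonal_to_col_mx a c (X : T -> 'cV[R]_a) (Y : T -> 'cV[R]_c) :
  orthogonal_to W X -> orthogonal_to W Y ->
  orthogonal_to W (fun t => col_mx (X t) (Y t)).
Proof.
move=> [lX X0] [lY Y0]; split; first exact: square_integrable_col_mx.
by rewrite cross_moment_col_mxl X0 Y0 col_mx0.
Qed.

Lemma orthogonal_to_col_mxr a c (V : T -> 'cV[R]_c) (X : T -> 'cV[R]_a) :
  orthogonal_to W X -> orthogonal_to V X ->
  orthogonal_to (fun t => col_mx (W t) (V t)) X.
Proof.
move=> [lX XW] [_ XV]; split=> //.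
rewrite -cross_moment_tr cross_moment_col_mxl -!(cross_moment_tr X) XW XV.
by rewrite !trmx0 col_mx0 trmx0.
Qed.

Lemma orthogonal_to_cst a (c : 'cV[R]_a) :
  mx_expectation P W = 0 -> orthogonal_to W (fun=> c).
Proof.
move=> W0; split; first exact: square_integrable_cst.
by rewrite cross_moment_cstl// W0 trmx0 mulmx0.
Qed.

End orthogonal_to_closed.

Lemma cross_moment_pythagoras n (X Y : T -> 'cV[R]_n) :
  square_integrable X -> square_integrable Y -> cross_moment X Y = 0 ->
  cross_moment (fun t => X t + Y t) (fun t => X t + Y t) =
  cross_moment X X + cross_moment Y Y.
Proof.
move=> lX lY XY; have lXY := square_integrableD lX lY.
rewrite cross_momentDl// !cross_momentDr// XY addr0.
by rewrite -(cross_moment_tr X Y) XY trmx0 add0r.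
Qed.

Lemma cross_moment_congr a b (A : 'M[R]_(a, b)) (X : T -> 'cV[R]_b) :
  square_integrable X ->
  cross_moment (fun t => A *m X t) (fun t => A *m X t) =
  A *m cross_moment X X *m A^T.
Proof.
move=> lX; rewrite cross_momentMl//; last exact: square_integrableM.
by rewrite cross_momentMr// mulmxA.
Qed.

(** * One step of a linear filter *)

Section linear_measurement.
Variables (n s : nat) (X Xp : T -> 'cV[R]_n) (V : T -> 'cV[R]_s).
Variables (K : 'M[R]_(n, s)) (C : 'M[R]_(s, n)).
Let Xf t := Xp t + K *m (C *m X t + V t - C *m Xp t).
Hypotheses (lX : square_integrable X) (lXp : square_integrable Xp).
Hypotheses (lV : square_integrable V).
Hypothesis eV : cross_moment (fun t => X t - Xp t) V = 0.

Let le : square_integrable (fun t => X t - Xp t).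
Proof. exact: square_integrableB. Qed.

(** Joseph form: the filtering error (I - K C) (X - Xp) - K V is a sum of two
    orthogonal terms, whatever the gain K. *)
Lemma error_cov_update : error_cov P X Xf =
  (1%:M - K *m C) *m error_cov P X Xp *m (1%:M - K *m C)^T +
  K *m cross_moment V V *m K^T.
Proof.
have -> : error_cov P X Xf = cross_moment
    (fun t => (1%:M - K *m C) *m (X t - Xp t) + - K *m V t)
    (fun t => (1%:M - K *m C) *m (X t - Xp t) + - K *m V t).
  suff e t : X t - Xf t = (1%:M - K *m C) *m (X t - Xp t) + - K *m V t.
    by congr mx_expectation; apply/funext => t; rewrite e.
  rewrite /Xf mulmxBl mul1mx addrAC -mulmxBr mulmxDr mulNmx -mulmxA opprD addrA.
  by rewrite opprD addrA.
rewrite cross_moment_pythagoras; [|exact: square_integrableM..|].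
  by rewrite !cross_moment_congr// linearN/= mulNmx mulmxN mulNmx opprK.
rewrite cross_momentMl//; last exact: square_integrableM.
by rewrite cross_momentMr// eV mul0mx mulmx0.
Qed.

(** The innovation nu = C (X - Xp) + V has E[(X - Xp) nu'] = E C' and
    E[nu nu'] = C E C' + E[V V'], where E is the prediction covariance. Since
    X - Xf = (X - Xp) - K nu, orthogonality of the filtering error to nu is the
    normal equation E C' = K (C E C' + E[V V']). *)
Lemma optimal_gain :
  cross_moment (fun t => X t - Xf t)
    (fun t => C *m X t + V t - C *m Xp t) = 0 ->
  C *m error_cov P X Xp *m C^T + cross_moment V V \in unitmx ->
  K = error_cov P X Xp *m C^T *m
      invmx (C *m error_cov P X Xp *m C^T + cross_moment V V).
Proof.
set E := error_cov P X Xp => nu0 uS.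
pose nu t := C *m (X t - Xp t) + V t.
have nuE : (fun t => C *m X t + V t - C *m Xp t) = nu.
  by apply/funext => t; rewrite /nu mulmxBr addrAC.
have lCe : square_integrable (fun t => C *m (X t - Xp t)).
  exact: square_integrableM.
have lnu : square_integrable nu by exact: square_integrableD.
have enu : cross_moment (fun t => X t - Xp t) nu = E *m C^T.
  by rewrite cross_momentDr// eV addr0 cross_momentMr.
have nunu : cross_moment nu nu = C *m E *m C^T + cross_moment V V.
  rewrite cross_moment_pythagoras ?cross_moment_congr//.
  by rewrite cross_momentMl// eV mulmx0.
have : E *m C^T = K *m (C *m E *m C^T + cross_moment V V).
  apply/eqP; rewrite -subr_eq0 -nunu -enu -cross_momentMl//.
  rewrite -cross_momentBl//; last exact: square_integrableM.
  rewrite -nu0 nuE; apply/eqP; congr cross_moment; apply/funext => t.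
  by rewrite /Xf opprD addrA /nu mulmxBr -(addrAC (C *m X t)).
by move=> ->; rewrite mulmxK.
Qed.

End linear_measurement.


End second_order.

(** * The coupled filters *)

(* Suffixes: p1, p2 = prediction (k|k-1) and f1, f2 = filtering (k|k) of
   controllers 1 and 2. *)
Theorem lemma3 (R : realType) (d : measure_display) (T : measurableType d)
  (Pb : probability T R) (m l r p q N : nat)
  (A : 'M[R]_m) (B1 : 'M[R]_(m, l)) (B2 : 'M[R]_(m, r))
  (H1 : 'M[R]_(p, m)) (H2 : 'M[R]_(q, m))
  (mu : 'cV[R]_m) (Sigma Qw : 'M[R]_m)
  (Qv1 : 'M[R]_p) (Qv2 : 'M[R]_q) (Qv : 'M[R]_(p + q))
  (Q Theta : 'M[R]_m) (R1 : 'M[R]_l) (R2 : 'M[R]_r)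
  (x w : nat -> T -> 'cV[R]_m)
  (u1 uhat utilde : nat -> T -> 'cV[R]_l) (u2 : nat -> T -> 'cV[R]_r)
  (y1 v1 : nat -> T -> 'cV[R]_p) (y2 v2 : nat -> T -> 'cV[R]_q)
  (xp1 xf1 xp2 xf2 : nat -> T -> 'cV[R]_m)
  (G : nat -> 'M[R]_(m, p + q)) (P S : nat -> 'M[R]_m) :
  let B : 'M[R]_(m, l + r) := row_mx B1 B2 in
  let H : 'M[R]_(p + q, m) := col_mx H1 H2 in
  let Rw : 'M[R]_(l + r) := block_mx R1 0 0 R2 in
  let y k t := col_mx (y1 k t) (y2 k t) in
  let v k t := col_mx (v1 k t) (v2 k t) in
  let u k t := col_mx (uhat k t) (u2 k t) in
  let F k := sigma_upto y k in
  let F2 k := sigma_upto y2 k in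
  let Sigma1p k := error_cov Pb (x k) (xp1 k) in
  let Sigma1f k := error_cov Pb (x k) (xf1 k) in
  let Sigma2p k := error_cov Pb (x k) (xp2 k) in
  let G2 k : 'M[R]_(m, q) :=
    Sigma2p k *m H2^T *m invmx (H2 *m Sigma2p k *m H2^T + Qv2) in
  let M k := B^T *m P k.+1 *m A in
  let Upsilon k := B^T *m P k.+1 *m B + Rw in
  let Phi k := (P k - S k) *m G2 k *m H2 + S k in
  let L0 k := B1^T *m (Phi k.+1)^T *m A in
  let L k := B1^T *m Phi k.+1 *m A in
  let Lambda k := B1^T *m Phi k.+1 *m B1 + R1 in
  let Gamma k := invmx (Lambda k) *m L k in
  (* plant and measurements *)
  (forall k t, (k <= N)%N ->
     x k.+1 t = A *m x k t + B1 *m u1 k t + B2 *m u2 k t + w k t) ->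
  (forall k t, (k <= N)%N -> y1 k t = H1 *m x k t + v1 k t) ->
  (forall k t, (k <= N)%N -> y2 k t = H2 *m x k t + v2 k t) ->
  (* initial state and noises *)
  has_mean_cov Pb (x 0%N) mu Sigma ->
  (forall k, (k <= N)%N -> has_mean_cov Pb (w k) 0 Qw) ->
  (forall k, (k <= N)%N -> has_mean_cov Pb (v1 k) 0 Qv1) ->
  (forall k, (k <= N)%N -> has_mean_cov Pb (v2 k) 0 Qv2) ->
  (forall k, (k <= N)%N -> cov_mx Pb (v k) = Qv) ->
  gaussian Pb (x 0%N) ->
  (forall k, (k <= N)%N ->
     [/\ gaussian Pb (w k), gaussian Pb (v1 k) & gaussian Pb (v2 k)]) ->
  mutually_independent Pb (@primitive_sigma _ _ _ _ _ _ N (x 0%N) w v1 v2) ->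
  (* information structure and decomposition of u1 *)
  (forall k, (k <= N)%N -> measurable_wrt (F k) (u1 k)) ->
  (forall k, (k <= N)%N -> measurable_wrt (F2 k) (u2 k)) ->
  (forall k, (k <= N)%N -> is_cond_exp Pb (F2 k) (u1 k) (uhat k)) ->
  (forall k t, (k <= N)%N -> utilde k t = u1 k t - uhat k t) ->
  (* weights *)
  psd Q -> psd R1 -> psd R2 -> psd Theta ->
  (* optimal filter of controller 1 *)
  (forall t, xp1 0%N t = mu) ->
  (forall k t, (k <= N)%N ->
     xp1 k.+1 t = A *m xf1 k t + B *m u k t + B1 *m utilde k t) ->
  (forall k t, (k <= N)%N ->
     xf1 k t = xp1 k t + G k *m (y k t - H *m xp1 k t)) ->
  (forall k, (k <= N)%N -> is_cond_exp Pb (F k) (x k) (xf1 k)) ->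
  (* optimal filter of controller 2 *)
  (forall t, xp2 0%N t = mu) ->
  (forall k t, (k <= N)%N -> xp2 k.+1 t = A *m xf2 k t + B *m u k t) ->
  (forall k t, (k <= N)%N ->
     xf2 k t = xp2 k t + G2 k *m (y2 k t - H2 *m xp2 k t)) ->
  (forall k, (k <= N)%N -> is_cond_exp Pb (F2 k) (x k) (xf2 k)) ->
  (* the inverses in the two filter gains exist *)
  (forall k, (k <= N)%N -> H *m Sigma1p k *m H^T + Qv \in unitmx) ->
  (forall k, (k <= N)%N -> H2 *m Sigma2p k *m H2^T + Qv2 \in unitmx) ->
  (* coupled Riccati equations *)
  P N.+1 = Theta -> S N.+1 = Theta ->
  (forall k, (k <= N)%N ->
     P k = A^T *m P k.+1 *m A - (M k)^T *m invmx (Upsilon k) *m M k + Q) ->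
  (forall k, (k <= N)%N ->
     S k = A^T *m Phi k.+1 *m A - (L0 k)^T *m invmx (Lambda k) *m L k + Q) ->
  (forall k, (k <= N)%N -> Upsilon k \in unitmx) ->
  (forall k, (k <= N)%N -> Lambda k \in unitmx) ->
  (* controllers *)
  (forall k t, (k <= N)%N ->
     u k t = - (invmx (Upsilon k) *m M k *m xf2 k t)) ->
  (forall k t, (k <= N)%N ->
     utilde k t = - (invmx (Lambda k) *m L k *m (xf1 k t - xf2 k t))) ->
  (forall k, (k <= N)%N ->
     Sigma2p k.+1 =
       (A - B1 *m Gamma k)
         *m ((1%:M - G2 k *m H2) *m Sigma2p k *m (1%:M - G2 k *m H2)^T
               + G2 k *m Qv2 *m (G2 k)^T - Sigma1f k)
         *m (A - B1 *m Gamma k)^T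
       + A *m Sigma1f k *m A^T + Qw)
  /\ Sigma1p 0%N = Sigma
  /\ (forall k, (k <= N)%N -> Sigma1p k.+1 = A *m Sigma1f k *m A^T + Qw)
  /\ (forall k, (k <= N)%N ->
        G k = Sigma1p k *m H^T *m invmx (H *m Sigma1p k *m H^T + Qv)
        /\ Sigma1f k =
             (1%:M - G k *m H) *m Sigma1p k *m (1%:M - G k *m H)^T
             + G k *m Qv *m (G k)^T).
Proof.
move=> B H Rw y v u F F2 Sigma1p Sigma1f Sigma2p G2 M Upsilon Phi L0 L Lambda
  Gamma.
move=> xS y1E y2E hx0 hw hv1 hv2 hv _ _ hind _ _ _ utE _ _ _ _.
move=> xp10 xp1S xf1E xf1C xp20 xp2S xf2E xf2C uS1 _ _ _ _ _ _ _ uC utC.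
have [lx0 _ covx0] := hx0.
have [lw Ew] : (forall k, (k <= N)%N -> square_integrable Pb (w k)) /\
    (forall k, (k <= N)%N -> mx_expectation Pb (w k) = 0).
  by split=> k /hw[].
have [lv1 Ev1] : (forall k, (k <= N)%N -> square_integrable Pb (v1 k)) /\
    (forall k, (k <= N)%N -> mx_expectation Pb (v1 k) = 0).
  by split=> k /hv1[].
have [lv2 Ev2] : (forall k, (k <= N)%N -> square_integrable Pb (v2 k)) /\
    (forall k, (k <= N)%N -> mx_expectation Pb (v2 k) = 0).
  by split=> k /hv2[].
have lv k : (k <= N)%N -> square_integrable Pb (v k).
  by move=> kN; apply: square_integrable_col_mx; [exact: lv1|exact: lv2].
have Ev k : (k <= N)%N -> mx_expectation Pb (v k) = 0.
  by move=> kN; apply: mx_expectation_col_mx0; [exact: Ev1|exact: Ev2].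
have Qww k : (k <= N)%N -> cross_moment Pb (w k) (w k) = Qw.
  by move=> kN; rewrite -cov_mx_centered ?Ew//; have [] := hw _ kN.
have Qvv k : (k <= N)%N -> cross_moment Pb (v k) (v k) = Qv.
  by move=> kN; rewrite -cov_mx_centered ?Ev ?hv.
have Qv2v2 k : (k <= N)%N -> cross_moment Pb (v2 k) (v2 k) = Qv2.
  by move=> kN; rewrite -cov_mx_centered ?Ev2//; have [] := hv2 _ kN.
pose Ku k := - (invmx (Upsilon k) *m M k).
have uE k : (k <= N)%N -> u k = (fun t => Ku k *m xf2 k t).
  by move=> kN; apply/funext => t; rewrite uC// mulNmx.
have utE' k : (k <= N)%N ->
    utilde k = (fun t => - Gamma k *m (xf1 k t - xf2 k t)).
  by move=> kN; apply/funext => t; rewrite utC// mulNmx.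
have xE k : (k <= N)%N ->
    x k.+1 = (fun t => A *m x k t + B *m u k t + B1 *m utilde k t + w k t).
  move=> kN; apply/funext => t; rewrite xS// utE// mul_row_col mulmxBr.
  congr (_ + w k t).
  rewrite -!addrA; congr (_ + _).
  by rewrite [RHS]addrC -!addrA addNr addr0 addrC.
have yE k : (k <= N)%N -> y k = (fun t => H *m x k t + v k t).
  by move=> kN; apply/funext => t; rewrite /y y1E// y2E// mul_col_mx add_col_mx.
have y2E' k : (k <= N)%N -> y2 k = (fun t => H2 *m x k t + v2 k t).
  by move=> kN; apply/funext => t; rewrite y2E.
have xp1E k : (k <= N)%N ->
    xp1 k.+1 = (fun t => A *m xf1 k t + B *m u k t + B1 *m utilde k t).
  by move=> kN; apply/funext => t; rewrite xp1S.
have xp2E k : (k <= N)%N -> xp2 k.+1 = (fun t => A *m xf2 k t + B *m u k t).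
  by move=> kN; apply/funext => t; rewrite xp2S.
have xf1E' k : (k <= N)%N ->
    xf1 k = (fun t => xp1 k t + G k *m (y k t - H *m xp1 k t)).
  by move=> kN; apply/funext => t; rewrite xf1E.
have xf2E' k : (k <= N)%N ->
    xf2 k = (fun t => xp2 k t + G2 k *m (y2 k t - H2 *m xp2 k t)).
  by move=> kN; apply/funext => t; rewrite xf2E.
have xp10' : xp1 0%N = (fun=> mu) by apply/funext.
have xp20' : xp2 0%N = (fun=> mu) by apply/funext.
have prim_orth i j a b (X : T -> 'cV[R]_a) (W : T -> 'cV[R]_b) : i != j ->
    primitive_sigma (x 0%N) w v1 v2 i = sigma_vec X ->
    @primitive_sigma _ _ _ _ _ _ N (x 0%N) w v1 v2 j = sigma_vec W ->
    square_integrable Pb X -> square_integrable Pb W ->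
    mx_expectation Pb W = 0 -> orthogonal_to Pb W X.
  move=> ij iX jW lX lW W0; split=> //.
  apply: independent_cross_moment => // A0 B0 XA WB.
  apply: (mutually_independent_pair _ hind ij); rewrite ?iX ?jW//.
  by case=> [?|[?|[?|?]]]; exact: sigma_gen_setT.
(* What the predictions at time k depend on. The noises at time k itself enter
   later, at the filtering step and at the next prediction. *)
pose past a k (W : T -> 'cV[R]_a) := [/\ square_integrable Pb W,
  mx_expectation Pb W = 0, orthogonal_to Pb W (x 0%N) &
  forall j, (j < k)%N -> [/\ orthogonal_to Pb W (w j),
    orthogonal_to Pb W (v1 j) & orthogonal_to Pb W (v2 j)]].
(* Orthogonality to W propagates along the closed loop. The measurement noises
   at time k enter at the filtering step and the process noise at the prediction
   step, so each step asks W to be orthogonal to what enters there. *)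
have orth_filter a (W : T -> 'cV[R]_a) k : (k <= N)%N ->
    square_integrable Pb W ->
    [/\ orthogonal_to Pb W (x k), orthogonal_to Pb W (xp1 k) &
        orthogonal_to Pb W (xp2 k)] ->
    orthogonal_to Pb W (v1 k) -> orthogonal_to Pb W (v2 k) ->
    orthogonal_to Pb W (xf1 k) /\ orthogonal_to Pb W (xf2 k).
  move=> kN lW [ox op1 op2] ov1 ov2; rewrite xf1E'// xf2E'// yE// y2E'//; split.
    apply: orthogonal_toD => //; apply: orthogonal_toM => //.
    apply: orthogonal_toB => //; last exact: orthogonal_toM.
    apply: orthogonal_toD => //; first exact: orthogonal_toM.
    exact: orthogonal_to_col_mx.
  apply: orthogonal_toD => //; apply: orthogonal_toM => //.
  apply: orthogonal_toB => //; last exact: orthogonal_toM.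
  by apply: orthogonal_toD => //; exact: orthogonal_toM.
have orth_predict a (W : T -> 'cV[R]_a) k : (k <= N.+1)%N -> past a k W ->
    [/\ orthogonal_to Pb W (x k), orthogonal_to Pb W (xp1 k) &
        orthogonal_to Pb W (xp2 k)].
  elim: k => [_ [lW W0 ox0 _]|k IHk kN [lW W0 ox0 oj]].
    by rewrite xp10' xp20'; split=> //; exact: orthogonal_to_cst.
  have [ox op1 op2] :=
    IHk (ltnW kN) (And4 lW W0 ox0 (fun j jk => oj j (ltnW jk))).
  have [ow ov1 ov2] := oj k (ltnSn k).
  have [of1 of2] := orth_filter _ W k kN lW (And3 ox op1 op2) ov1 ov2.
  have ou : orthogonal_to Pb W (u k) by rewrite uE//; exact: orthogonal_toM.
  have out : orthogonal_to Pb W (utilde k).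
    by rewrite utE'//; apply: orthogonal_toM => //; exact: orthogonal_toB.
  have oM c e (D : 'M[R]_(c, e)) (X : T -> 'cV[R]_e) :=
    @orthogonal_toM _ _ _ Pb _ W lW c e D X.
  rewrite xE// xp1E// xp2E//; split.
  - apply: orthogonal_toD => //; apply: orthogonal_toD => //; last exact: oM.
    by apply: orthogonal_toD => //; exact: oM.
  - apply: orthogonal_toD => //; last exact: oM.
    by apply: orthogonal_toD => //; exact: oM.
  - by apply: orthogonal_toD => //; exact: oM.
(* Orthogonality to the constant 0 in dimension 0 is exactly square
   integrability, so it propagates along the closed loop in the same way. *)
have null k : (k <= N.+1)%N -> past 0%N k (fun=> 0).
  have o0 n (X : T -> 'cV[R]_n) : square_integrable Pb X ->
      orthogonal_to Pb (fun=> 0 : 'cV[R]_0) X.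
    by move=> lX; split=> //; apply/matrixP => i [].
  move=> kN; split.
  - exact: square_integrable_cst.
  - by apply/matrixP; case.
  - exact: o0.
  - move=> j /leq_trans/(_ kN); rewrite ltnS => jN.
    by split; apply: o0; [exact: lw|exact: lv1|exact: lv2].
have [lx lp1 lp2] : [/\ forall k, (k <= N.+1)%N -> square_integrable Pb (x k),
    forall k, (k <= N.+1)%N -> square_integrable Pb (xp1 k) &
    forall k, (k <= N.+1)%N -> square_integrable Pb (xp2 k)].
  by split=> k kN; have [[]] := orth_predict _ _ _ kN (null k kN); try by [];
    [move=> _ _ []|move=> _ _ _ []].
pose I : Type := (unit + ('I_N.+1 + ('I_N.+1 + 'I_N.+1)))%type.
pose iw k (kN : (k < N.+1)%N) : I := inr (inl (Ordinal kN)).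
pose iv1 k (kN : (k < N.+1)%N) : I := inr (inr (inl (Ordinal kN))).
pose iv2 k (kN : (k < N.+1)%N) : I := inr (inr (inr (Ordinal kN))).
have ordneq j k (hj : (j < N.+1)%N) (hk : (k < N.+1)%N) :
    (j < k)%N -> Ordinal hj != Ordinal hk.
  by move=> jk; apply/eqP => -[e]; rewrite e ltnn in jk.
have past_w k : (k <= N)%N -> [/\ past _ k (w k),
    orthogonal_to Pb (w k) (v1 k) & orthogonal_to Pb (w k) (v2 k)].
  rewrite -ltnS => kN; split; first split; [exact: lw|exact: Ew|..].
  - by apply: (prim_orth (inl tt) (iw _ kN)) => //; [exact: lw|exact: Ew].
  - move=> j jk; have jN := ltn_trans jk kN; split.
    + apply: (prim_orth (iw _ jN) (iw _ kN)) => //;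
        [exact: ordneq|exact: lw|exact: lw|exact: Ew].
    + apply: (prim_orth (iv1 _ jN) (iw _ kN)) => //;
        [exact: lv1|exact: lw|exact: Ew].
    + apply: (prim_orth (iv2 _ jN) (iw _ kN)) => //;
        [exact: lv2|exact: lw|exact: Ew].
  - apply: (prim_orth (iv1 _ kN) (iw _ kN)) => //;
      [exact: lv1|exact: lw|exact: Ew].
  - apply: (prim_orth (iv2 _ kN) (iw _ kN)) => //;
      [exact: lv2|exact: lw|exact: Ew].
have past_v1 k : (k <= N)%N -> past _ k (v1 k).
  rewrite -ltnS => kN; split; [exact: lv1|exact: Ev1|..].
  - apply: (prim_orth (inl tt) (iv1 _ kN)) => //;
      [exact: lv1|exact: Ev1].
  - move=> j jk; have jN := ltn_trans jk kN; split.
    + apply: (prim_orth (iw _ jN) (iv1 _ kN)) => //;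
        [exact: lw|exact: lv1|exact: Ev1].
    + apply: (prim_orth (iv1 _ jN) (iv1 _ kN)) => //;
        [exact: ordneq|exact: lv1|exact: lv1|exact: Ev1].
    + apply: (prim_orth (iv2 _ jN) (iv1 _ kN)) => //;
        [exact: lv2|exact: lv1|exact: Ev1].
have past_v2 k : (k <= N)%N -> past _ k (v2 k).
  rewrite -ltnS => kN; split; [exact: lv2|exact: Ev2|..].
  - apply: (prim_orth (inl tt) (iv2 _ kN)) => //;
      [exact: lv2|exact: Ev2].
  - move=> j jk; have jN := ltn_trans jk kN; split.
    + apply: (prim_orth (iw _ jN) (iv2 _ kN)) => //;
        [exact: lw|exact: lv2|exact: Ev2].
    + apply: (prim_orth (iv1 _ jN) (iv2 _ kN)) => //;
        [exact: lv1|exact: lv2|exact: Ev2].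
    + apply: (prim_orth (iv2 _ jN) (iv2 _ kN)) => //;
        [exact: ordneq|exact: lv2|exact: lv2|exact: Ev2].
have lf k : (k <= N)%N ->
    square_integrable Pb (xf1 k) /\ square_integrable Pb (xf2 k).
  move=> kN; have := null k.+1 kN => -[l0 _ _ /(_ k (ltnSn k))[_ o1 o2]].
  have op := orth_predict _ _ _ (leqW kN) (null k (leqW kN)).
  have [[lf1 _] [lf2 _]] := orth_filter _ _ _ kN l0 op o1 o2.
  by split.
have w_orth k : (k <= N)%N -> [/\ orthogonal_to Pb (w k) (x k),
    orthogonal_to Pb (w k) (xf1 k) & orthogonal_to Pb (w k) (xf2 k)].
  move=> kN; have [pw o1 o2] := past_w k kN.
  have op := orth_predict _ _ _ (leqW kN) pw; have [ox _ _] := op.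
  by have [] := orth_filter _ _ _ kN (lw _ kN) op o1 o2.
have v_orth k : (k <= N)%N -> orthogonal_to Pb (v k) (fun t => x k t - xp1 k t).
  move=> kN; apply: orthogonal_to_col_mxr.
    have [ox op _] := orth_predict _ _ _ (leqW kN) (past_v1 k kN).
    by apply: orthogonal_toB => //; exact: lv1.
  have [ox op _] := orth_predict _ _ _ (leqW kN) (past_v2 k kN).
  by apply: orthogonal_toB => //; exact: lv2.
have v2_orth k : (k <= N)%N ->
    orthogonal_to Pb (v2 k) (fun t => x k t - xp2 k t).
  move=> kN; have [ox _ op] := orth_predict _ _ _ (leqW kN) (past_v2 k kN).
  by apply: orthogonal_toB => //; exact: lv2.
have ly k : (k <= N)%N -> square_integrable Pb (y k).
  move=> kN; rewrite yE//; apply: square_integrableD; last exact: lv.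
  by apply: square_integrableM; exact: lx (leqW kN).
have Fm k : (k <= N)%N -> F k `<=` measurable.
  move=> kN; apply: sigma_upto_sub => [|j jk].
    exact: sigma_algebra_measurable.
  by apply: square_integrable_measurable; apply: ly; exact: leq_trans kN.
have F2F j k : (j <= k)%N -> F2 j `<=` F k.
  move=> jk; apply: sigma_upto_sub => [|i ij].
    exact: sigma_algebra_sigma_gen.
  move=> a D mD.
  have := @sigma_upto_obs _ _ _ _ y i k (leq_trans ij jk) (rshift p a) D mD.
  by under eq_fun do rewrite col_mxEd.
have FF j k : (j <= k)%N -> F j `<=` F k.
  move=> jk; apply: sigma_upto_sub => [|i ij].
    exact: sigma_algebra_sigma_gen.
  by apply: sigma_upto_obs; exact: leq_trans jk.
have xf1_mF j k : (j <= k)%N -> (k <= N)%N -> measurable_wrt (F k) (xf1 j).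
  move=> jk kN; have [m1 _] := xf1C j (leq_trans jk kN).
  exact: measurable_wrt_sub (FF _ _ jk) m1.
have xf2_mF j k : (j <= k)%N -> (k <= N)%N -> measurable_wrt (F k) (xf2 j).
  move=> jk kN; have [m2 _] := xf2C j (leq_trans jk kN).
  exact: measurable_wrt_sub (F2F _ _ jk) m2.
have e1_orth k n (Z : T -> 'cV[R]_n) : (k <= N)%N -> square_integrable Pb Z ->
    measurable_wrt (F k) Z -> cross_moment Pb (fun t => x k t - xf1 k t) Z = 0.
  move=> kN lZ mZ; apply: (cond_exp_orthogonal _ _ _ _ (xf1C k kN) mZ) => //.
  - exact: Fm.
  - exact: lx (leqW kN).
  - by have [] := lf k kN.
(* For k > 0, xp1 k is a linear combination of xf1 and xf2 at time k - 1, both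
   measurable for the observations up to time k. *)
have xp1_orth k : (k <= N)%N ->
    orthogonal_to Pb (fun t => x k t - xf1 k t) (xp1 k).
  move=> kN; set e := fun t => _.
  have le : square_integrable Pb e.
    apply: square_integrableB; first exact: lx (leqW kN).
    by have [] := lf k kN.
  have ortho n (Z : T -> 'cV[R]_n) : square_integrable Pb Z ->
      measurable_wrt (F k) Z -> orthogonal_to Pb e Z.
    move=> lZ mZ; split=> //.
    by rewrite -cross_moment_tr e1_orth// trmx0.
  case: k kN @e le ortho => [|j] kN e le ortho.
    rewrite xp10'; apply: ortho; first exact: square_integrable_cst.
    move=> i D mD; rewrite preimage_cst; case: ifP => _.
      exact: sigma_gen_setT.
    exact: sigma_algebra0.
  have jN := ltnW kN; have [lf1 lf2] := lf j jN.
  have of1 := ortho _ _ lf1 (xf1_mF _ _ (leqnSn j) kN).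
  have of2 := ortho _ _ lf2 (xf2_mF _ _ (leqnSn j) kN).
  rewrite xp1E// uE// utE'//.
  apply: orthogonal_toD => //; last first.
    by do 2 apply: orthogonal_toM => //; exact: orthogonal_toB.
  by apply: orthogonal_toD => //; do ?apply: orthogonal_toM => //.
have innovation_orth k : (k <= N)%N -> cross_moment Pb
    (fun t => x k t - xf1 k t) (fun t => H *m x k t + v k t - H *m xp1 k t) = 0.
  move=> kN; set e := fun t => _.
  have le : square_integrable Pb e.
    apply: square_integrableB; first exact: lx (leqW kN).
    by have [] := lf k kN.
  rewrite -cross_moment_tr.
  suff [_ ->] : orthogonal_to Pb e (fun t => H *m x k t + v k t - H *m xp1 k t).
    by rewrite trmx0.
  apply: orthogonal_toB => //; last first.
    by apply: orthogonal_toM => //; exact: xp1_orth.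
  rewrite -yE//; split; first exact: ly.
  rewrite -cross_moment_tr e1_orth ?trmx0//; first exact: ly.
  exact: sigma_upto_obs.
have sigma2f_joseph k : (k <= N)%N -> error_cov Pb (x k) (xf2 k) =
    (1%:M - G2 k *m H2) *m Sigma2p k *m (1%:M - G2 k *m H2)^T
    + G2 k *m Qv2 *m (G2 k)^T.
  move=> kN; rewrite xf2E'// y2E'// -(Qv2v2 k)//.
  apply: error_cov_update;
    [exact: lx (leqW kN)|exact: lp2 (leqW kN)|exact: lv2|].
  by have [] := v2_orth k kN.
split; [|split; [|split]].
- move=> k kN; have [lf1 lf2] := lf k kN.
  pose e t := x k t - xf1 k t; pose delta t := xf1 k t - xf2 k t.
  have le : square_integrable Pb e.
    by apply: square_integrableB => //; exact: lx (leqW kN).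
  have ld : square_integrable Pb delta by exact: square_integrableB.
  have ed : cross_moment Pb e delta = 0.
    rewrite cross_momentBr// !e1_orth// ?subr0//.
      exact: xf2_mF.
    exact: xf1_mF.
  (* Pythagoras for x - xf2 = e + delta, read backwards *)
  have dd : cross_moment Pb delta delta =
      error_cov Pb (x k) (xf2 k) - Sigma1f k.
    apply/eqP; rewrite eq_sym subr_eq addrC; apply/eqP.
    rewrite -[Sigma1f k]/(cross_moment Pb e e) -cross_moment_pythagoras//.
    congr mx_expectation; apply/funext => t.
    by rewrite /e /delta addrA subrK.
  have [ox of1 of2] := w_orth k kN.
  have [lr rw] : orthogonal_to Pb (w k)
      (fun t => A *m e t + (A - B1 *m Gamma k) *m delta t).
    have lwk := lw _ kN.
    by apply: orthogonal_toD => //; apply: orthogonal_toM => //;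
      exact: orthogonal_toB.
  have -> : Sigma2p k.+1 = cross_moment Pb
      (fun t => A *m e t + (A - B1 *m Gamma k) *m delta t + w k t)
      (fun t => A *m e t + (A - B1 *m Gamma k) *m delta t + w k t).
    suff eS t : x k.+1 t - xp2 k.+1 t =
        A *m e t + (A - B1 *m Gamma k) *m delta t + w k t.
      by congr mx_expectation; apply/funext => t; rewrite eS.
    rewrite xE// xp2E// utE'// mulNmx mulmxN addrAC; congr (_ + _).
    rewrite addrAC opprD addrACA subrr addr0 mulmxBl addrA.
    congr (_ - _); last by rewrite mulmxA.
    by rewrite -mulmxBr -mulmxDr /e /delta addrA subrK.
  rewrite (cross_moment_pythagoras lr (lw k kN) rw).
  rewrite cross_moment_pythagoras; [|exact: square_integrableM..|]; last first.
    rewrite cross_momentMl//; last exact: square_integrableM.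
    by rewrite cross_momentMr// ed mul0mx mulmx0.
  rewrite !cross_moment_congr// Qww// dd sigma2f_joseph//.
  by rewrite [A *m _ *m _ + _]addrC.
- have [_ Ex0 _] := hx0.
  by rewrite -covx0 /Sigma1p /error_cov /cov_mx Ex0 xp10'.
- move=> k kN; have [lf1 lf2] := lf k kN.
  pose e t := x k t - xf1 k t.
  have [ox of1 _] := w_orth k kN.
  have [le ew] : orthogonal_to Pb (w k) e.
    by apply: orthogonal_toB => //; exact: lw.
  have -> : Sigma1p k.+1 = cross_moment Pb
      (fun t => A *m e t + w k t) (fun t => A *m e t + w k t).
    suff eS t : x k.+1 t - xp1 k.+1 t = A *m e t + w k t.
      by congr mx_expectation; apply/funext => t; rewrite eS.
    rewrite xE// xp1E// addrAC; congr (_ + _).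
    by rewrite !opprD addrACA subrr addr0 addrACA subrr addr0 mulmxBr.
  rewrite cross_moment_pythagoras; [|exact: square_integrableM|exact: lw|].
    by rewrite cross_moment_congr// Qww.
  by rewrite cross_momentMl ?ew ?mulmx0//; exact: lw.
- move=> k kN.
  have lxk := lx _ (leqW kN); have lpk := lp1 _ (leqW kN); have lvk := lv _ kN.
  have [_ ev] := v_orth k kN.
  have := innovation_orth k kN; have := error_cov_update (G k) H lxk lpk lvk ev.
  have := optimal_gain (K := G k) (C := H) lxk lpk lvk ev.
  rewrite Qvv// /Sigma1f xf1E'// yE// => gain upd1 inn; split=> //.
  by apply: gain => //; exact: uS1.
Qed.
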